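(* Let $D$ be an $n$-diagram, $S$ an $m$-diagram and $M$ an $l$-diagram, all well-defined, with $m,n,l\ge 1$. Put $a=\min(n,l)-1$, $b=\min(m,\max(n,l))-1$, $c=\min(m,n)-1$ and $d=\min(\max(m,n),l)-1$. Then, provided that the composites involved exist, the following hold: $$S\circ_a(D\circ_a M)=(S\circ_a D)\circ_a M\qquad\text{if } a=b;$$ $$S\circ_b(D\circ_a M)=(S\circ_b D)\circ_a(S\circ_b M)\qquad\text{if } b<a;$$ $$(S\circ_c D)\circ_d M=(S\circ_d M)\circ_c(D\circ_d M)\qquad\text{if } d<c.$$
   Context: The following notions are defined by mutual recursion on dimension. Signature: for $n\ge 0$, an $n$-signature $\Sigma$ is a family of sets $(\Sigma_0,\dots,\Sigma_n)$ such that, when $n>0$, $(\Sigma_0,\dots,\Sigma_{n-1})$ is an $(n-1)$-signature and each $g\in\Sigma_n$ is equipped with well-defined $(n-1)$-diagrams $g.s,g.t$ over it, satisfying $g.s.s=g.t.s$ and $g.s.t=g.t.t$ when $n>1$. All diagrams are over one fixed signature (a $k$-diagram being over its truncation $(\Sigma_0,\dots,\Sigma_k)$). Diagram: a $0$-diagram $D$ has length $|D|=1$ and consists of one generator $D[0].g\in\Sigma_0$. For $n>0$, an $n$-diagram $D$ consists of a source $(n-1)$-diagram $D.s$ and a list of length $|D|\ge 0$ whose $i$-th entry ($0\le i<|D|$) is a generator $D[i].g\in\Sigma_n$ with an embedding $D[i].e:D[i].g.s\hookrightarrow D[i].d$. Slices: $D[0].d:=D.s$ and $D[i+1].d:=(D[i].d).\Pi[D[i].e,\,D[i].g.t]$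 for $0\le i<|D|$. Target: $D.t:=D[|D|].d$. An $n$-diagram is well-defined if $n=0$, or if $n>0$, $D.s$ is well-defined, all embeddings $D[i].e$ are well-defined, and all slices $D[i].d$, $0<i\le|D|$, exist and are well-defined. Two $n$-diagrams $S,T$ are globular if $n=0$, or $n>0$ and $S.s=T.s$, $S.t=T.t$. Embedding: an embedding $e:S\hookrightarrow D$ of $n$-diagrams has no data if $n=0$; if $n>0$ it consists of a natural number $e.h\le |D|$ and an embedding $e.e:S.s\hookrightarrow D[e.h].d$. An embedding between well-defined diagrams is well-defined if: for $n=0$, $S[0].g=D[0].g$; for $n>0$, $e.e$ is well-defined and for all $0\le i<|S|$ (with $i+e.h<|D|$) $S[i].g=D[i+e.h].g$ and $(e.e).\Lambda[S[i].d]\circ S[i].e=D[i+e.h].e$. Rewrite: for $e:S\hookrightarrow D$ and $T$ globular with $S$, the $n$-diagram $D.\Pi[e,T]$ is: if $n=0$, the diagram with generator $T[0].g$; if $n>0$, it has source $D.s$, length $|D|-|S|+|T|$, and its $i$-th generator and embedding are: $D[i].g$, $D[i].e$ for $0\le i<e.h$; $T[i-e.h].g$, $(e.e).\Lambda[T[i-e.h].d]\circ T[i-e.h].e$ for $e.h\le i<e.h+|T|$; $D[i-|T|+|S|].g$, $D[i-|T|+|S|].e$ for $e.h+|T|\le i<|D|-|S|+|T|$. Lift: for $e:S\hookrightarrow D$ and $T$ globular with $S$, $e.\Lambda[T]:T\hookrightarrow D.\Pi[e,T]$ has, for $n>0$, $e.\Lambda[T].h=e.h$ and $e.\Lambda[T].e=e.e$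 (no data for $n=0$). Composite embedding: for $e:S\hookrightarrow D$, $f:D\hookrightarrow A$, $f\circ e:S\hookrightarrow A$ has, for $n>0$, $(f\circ e).h=e.h+f.h$ and $(f\circ e).e=(f.e).\Lambda[D[e.h].d]\circ e.e$ (no data for $n=0$). Equality: two embeddings are equal if their domains and codomains are equal and, for $n>0$, their $.h$ and $.e$ components are equal; two diagrams are equal if their lengths, corresponding generators and, for $n>0$, corresponding embeddings and sources are equal. Iterated boundaries: $s^k(D)$ and $t^k(D)$ denote the result of taking the source, respectively the target, $k$ times. Identity embedding: $D.\mathrm{id}:D\hookrightarrow D$ has no data for $n=0$; for $n>0$, $D.\mathrm{id}.h=0$ and $D.\mathrm{id}.e=D.s.\mathrm{id}$. Diagram composition and inclusions (mutually recursive): let $S$ be an $m$-diagram and $D$ an $n$-diagram, $m,n\ge 1$. The composite $S\circ D$ exists when either $m\le n$ and $S.t=s^{n-m+1}(D)$, or $m>n$ and $t^{m-n+1}(S)=D.s$; it is the following $\max(m,n)$-diagram. It is also written $S\circ_k D$ with $k=\min(m,n)-1$; the subscript is determined by the dimensions and carries no extra data. If $m=n$: source $S.s$, length $|S|+|D|$, with $j$-th generator and embedding $S[j].g,S[j].e$ for $0\le j<|S|$ and $D[j-|S|].g,D[j-|S|].e$ for $|S|\le j<|S|+|D|$. If $m<n$: source $S\circ(D.s)$, length $|D|$, $j$-th generator $D[j].g$, $j$-th embedding $\mathrm{Inc}_{\mathrm r}(S,D[j].d)\circ D[j].e$. If $m>n$: source $(S.s)\circ D$, length $|S|$, $j$-th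 generator $S[j].g$, $j$-th embedding $\mathrm{Inc}_{\mathrm l}(S[j].d,D)\circ S[j].e$. For $m\le n$ the right inclusion $\mathrm{Inc}_{\mathrm r}(S,D):D\hookrightarrow S\circ D$ has: if $m=n$, height $|S|$ and component embedding $D.s.\mathrm{id}$; if $m<n$, height $0$ and component embedding $\mathrm{Inc}_{\mathrm r}(S,D.s)$. For $n\le m$ the left inclusion $\mathrm{Inc}_{\mathrm l}(S,D):S\hookrightarrow S\circ D$ has height $0$ and component embedding $S.s.\mathrm{id}$ if $m=n$, and $\mathrm{Inc}_{\mathrm l}(S.s,D)$ if $n<m$. *)

(* Defs.v *)
From mathcomp Require Import all_boot.

Set Implicit Arguments.
Unset Strict Implicit.
Unset Printing Implicit Defensive.

(* Data of an n-embedding: the height e.1 and the component embedding e.2.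
   The domain and codomain are not stored, they are always determined by the
   context; [emb_eq] below compares them together with the data. *)
Fixpoint emb (n : nat) : Type :=
  if n is n'.+1 then (nat * emb n')%type else unit.

(* Data of an n-diagram over the generators G: D.1 is the source and the i-th
   entry (g, e) of D.2 is the generator D[i].g with the embedding
   D[i].e : D[i].g.s -> D[i].d.  Since that domain and codomain are functions of
   the data, equality of diagrams is Leibniz equality.  A 0-diagram is its single
   generator. *)
Fixpoint diag (G : nat -> Type) (n : nat) : Type :=
  if n is n'.+1 then (diag G n' * seq (G n'.+1 * emb n'))%type else G 0.

Record presignature := Presignature {
  gen : nat -> Type;
  gsrc : forall n, gen n.+1 -> diag gen n;
  gtgt : forall n, gen n.+1 -> diag gen n
}.

Notation diagram X := (diag (gen X)).

Fixpoint emb_id (n : nat) : emb n :=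
  if n is n'.+1 return emb n then (0, emb_id n') else tt.

(* The lift of e along T; T only affects its domain and codomain, T and
   [rewr D S e T]. *)
Definition emb_lift (n : nat) : emb n -> emb n :=
  if n is n'.+1 return emb n -> emb n then fun e => (e.1, e.2) else fun=> tt.

(* [emb_comp f e] is f \o e; the inner [emb_lift] is along D[e.h].d. *)
Fixpoint emb_comp (n : nat) : emb n -> emb n -> emb n :=
  if n is n'.+1 return emb n -> emb n -> emb n then
    fun f e => (e.1 + f.1, emb_comp (emb_lift f.2) e.2)
  else fun _ _ => tt.

Section Diagrams.
Context {X : presignature}.

(* |D| *)
Definition len (n : nat) : diagram X n -> nat :=
  if n is n'.+1 return diagram X n -> nat then fun D => size D.2 else fun=> 1.

(* D.Pi[e, T] for e : S -> D *)
Definition rewr (n : nat) :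
    diagram X n -> diagram X n -> emb n -> diagram X n -> diagram X n :=
  if n is n'.+1
    return diagram X n -> diagram X n -> emb n -> diagram X n -> diagram X n
  then fun D S e T =>
    (D.1, take e.1 D.2 ++ [seq (x.1, emb_comp (emb_lift e.2) x.2) | x <- T.2]
          ++ drop (e.1 + len (n := n'.+1) S) D.2)
  else fun _ _ _ T => T.

(* D[i].d, for i <= |D| *)
Definition slice (n : nat) (D : diagram X n.+1) (i : nat) : diagram X n :=
  foldl (fun E x => rewr E (gsrc x.1) x.2 (gtgt x.1)) D.1 (take i D.2).

(* The source and target of a 0-diagram are junk values (the diagram itself). *)
Definition src (n : nat) : diagram X n -> diagram X n.-1 :=
  if n is n'.+1 return diagram X n -> diagram X n.-1 then fun D => D.1 else id.

Definition tgt (n : nat) : diagram X n -> diagram X n.-1 :=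
  if n is n'.+1 return diagram X n -> diagram X n.-1
  then fun D => slice D (size D.2) else id.

(* s^k and t^k *)
Fixpoint iter_src (k n : nat) (D : diagram X n) : diagram X (iter k predn n) :=
  if k is k'.+1 return diagram X (iter k predn n) then src (iter_src k' D)
  else D.

Fixpoint iter_tgt (k n : nat) (D : diagram X n) : diagram X (iter k predn n) :=
  if k is k'.+1 return diagram X (iter k predn n) then tgt (iter_tgt k' D)
  else D.

Definition globular (n : nat) (S T : diagram X n) : Prop :=
  0 < n -> src S = src T /\ tgt S = tgt T.

(* Equality of e : S -> D and e' : S' -> D'. *)
Definition emb_eq (n : nat) (S D : diagram X n) (e : emb n)
    (S' D' : diagram X n) (e' : emb n) : Prop :=
  [/\ S = S', D = D' & e = e'].

(* e is a well-defined embedding S -> D, for S and D well-defined. *)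
Fixpoint wd_emb (n : nat) : diagram X n -> diagram X n -> emb n -> Prop :=
  if n is n'.+1 return diagram X n -> diagram X n -> emb n -> Prop then
    fun S D e =>
      [/\ e.1 <= size D.2,
          wd_emb S.1 (slice D e.1) e.2
        & forall i x, onth S.2 i = Some x ->
            exists y, [/\ onth D.2 (i + e.1) = Some y, x.1 = y.1
              & emb_eq (gsrc x.1) (rewr (slice D e.1) S.1 e.2 (slice S i))
                       (emb_comp (emb_lift e.2) x.2)
                       (gsrc y.1) (slice D (i + e.1)) y.2]]
  else fun S D _ => S = D.

(* The slices exist as soon as the embeddings are well-defined, because the
   source and target of a generator of a signature are globular. *)
Fixpoint wd (n : nat) : diagram X n -> Prop :=
  if n is n'.+1 return diagram X n -> Prop then
    fun D =>
      [/\ wd D.1,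
          forall i x, onth D.2 i = Some x ->
            wd_emb (gsrc x.1) (slice D i) x.2
        & forall i, 0 < i <= size D.2 -> wd (slice D i)]
  else fun=> True.

(* Equality of diagrams whose dimensions are only provably equal. *)
Definition deq (m n : nat) (S : diagram X m) (D : diagram X n) : Prop :=
  Tagged (diagram X) S = Tagged (diagram X) D.

(* Inc_r(S, D) : D -> S \o D for 1 <= m <= n and Inc_l(S, D) : S -> S \o D for
   1 <= n <= m.  Their data depend on D, resp. on D and S, only through the
   dimensions.  The values for dimension 0 are junk. *)
Fixpoint inc_r (m : nat) (S : diagram X m) (n : nat) : emb n :=
  if n is n'.+1 return emb n then
    if m == n'.+1 then (len S, emb_id n') else (0, inc_r S n')
  else tt.

Fixpoint inc_l (m n : nat) : emb m :=
  if m is m'.+1 return emb m then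
    if m == n then (0, emb_id m') else (0, inc_l m' n)
  else tt.

(* S \o D for m = n >= 1 *)
Definition comp_eq (n : nat) : diagram X n -> diagram X n -> diagram X n :=
  if n is n'.+1 return diagram X n -> diagram X n -> diagram X n then
    fun S D => (S.1, S.2 ++ D.2)
  else fun S _ => S.

(* S \o D for 1 <= m <= n *)
Fixpoint comp_r (m : nat) (S : diagram X m) (n : nat) :
    diagram X n -> diagram X n :=
  if n is n'.+1 return diagram X n -> diagram X n then
    fun D =>
      match @eqP _ m n'.+1 with
      | ReflectT mn => comp_eq (n := n'.+1) (ecast k (diagram X k) mn S) D
      | ReflectF _ =>
          (comp_r S D.1, [seq (x.1, emb_comp (inc_r S n') x.2) | x <- D.2])
      end
  else id.

(* S \o D for 1 <= n <= m *)
Fixpoint comp_l (m : nat) (n : nat) (D : diagram X n) :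
    diagram X m -> diagram X m :=
  if m is m'.+1 return diagram X m -> diagram X m then
    fun S =>
      match @eqP _ n m'.+1 with
      | ReflectT nm => comp_eq (n := m'.+1) S (ecast k (diagram X k) nm D)
      | ReflectF _ =>
          (comp_l D S.1, [seq (x.1, emb_comp (inc_l m' n) x.2) | x <- S.2])
      end
  else id.

(* S \o D for m, n >= 1.  [maxn m n] is [if m < n then n else m]. *)
Definition compose (m n : nat) (S : diagram X m) (D : diagram X n) :
    diagram X (maxn m n) :=
  if m < n as b return diagram X (if b then n else m)
  then comp_r S D else comp_l D S.

Definition composable (m n : nat) (S : diagram X m) (D : diagram X n) : Prop :=
  if m <= n then deq (tgt S) (iter_src (n - m + 1) D)
  else deq (iter_tgt (m - n + 1) S) (src D).

End Diagrams.

Arguments deq {X m n} S D.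

(* (gen X 0, ..., gen X n) is an n-signature; higher generators are ignored. *)
Fixpoint is_signature (X : presignature) (n : nat) : Prop :=
  if n is n'.+1 then
    is_signature X n' /\
    forall g : gen X n'.+1,
      [/\ wd (gsrc g), wd (gtgt g) & globular (gsrc g) (gtgt g)]
  else True.

(* Main.v *)
(* On data, composing embeddings adds heights coordinatewise, the left inclusion
   is zero, and Inc_r(S, -) is |S| in the coordinate of dim S and zero elsewhere.
   So all laws follow by descending through sources until two diagrams of equal
   dimension meet, where composition is concatenation.  The shifts accumulated
   on the way agree because addition is commutative and associative and because
   composing with a diagram of smaller dimension preserves the length. *)
Require Import Defs.
From mathcomp Require Import all_boot zify.

Set Implicit Arguments.
Unset Strict Implicit.
Unset Printing Implicit Defensive.

(** * Composition of embedding data as a commutative monoid *)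

Lemma emb_liftE n (e : emb n) : emb_lift e = e.
Proof. by case: n e => [|n] []. Qed.

Lemma emb_compC n : commutative (@emb_comp n).
Proof. by elim: n => [|n IHn] // f e /=; rewrite !emb_liftE addnC IHn. Qed.

Lemma emb_compA n : associative (@emb_comp n).
Proof. by elim: n => [|n IHn] // g f e /=; rewrite !emb_liftE IHn addnA. Qed.

Lemma emb_compCA n : left_commutative (@emb_comp n).
Proof. by move=> g f e; rewrite !emb_compA (emb_compC g). Qed.

Lemma emb_comp_id n : left_id (emb_id n) (@emb_comp n).
Proof. by elim: n => [|n IHn] [] //= h e; rewrite emb_liftE IHn addn0. Qed.

Lemma inc_l_id m n : inc_l m n = emb_id m.
Proof. by elim: m => [|m IHm] //=; rewrite IHm if_same. Qed.

Section Compositions.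
Context {X : presignature}.
Implicit Types m n l : nat.

(** * Right inclusions and the unfolding of composites by one dimension *)

Lemma eq_inc_r m (S T : diagram X m) n : len S = len T -> inc_r S n = inc_r T n.
Proof. by move=> eqST; elim: n => [|n IHn] //=; rewrite eqST IHn. Qed.

Lemma inc_r_comp_eq m (S D : diagram X m) n :
  0 < m -> inc_r (comp_eq S D) n = emb_comp (inc_r S n) (inc_r D n).
Proof.
case: m S D => // m S D _; elim: n => [|n IHn] //=.
case: ifP => _ /=; rewrite emb_liftE.
  by rewrite size_cat addnC emb_comp_id.
by rewrite IHn.
Qed.

Lemma comp_r_eq n (S D : diagram X n) : 0 < n -> comp_r S D = comp_eq S D.
Proof.
(* The cast is along a proof of [n.+1 = n.+1]; such proofs are unique on [nat], so it vanishes. *)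
by case: n S D => // n S D _ /=; case: eqP => // e; rewrite eq_axiomK.
Qed.

Lemma comp_l_eq n (S D : diagram X n) : 0 < n -> comp_l D S = comp_eq S D.
Proof.
by case: n S D => // n S D _ /=; case: eqP => // e; rewrite eq_axiomK.
Qed.

Lemma comp_r_lt m n (S : diagram X m) (D : diagram X n.+1) : m <= n ->
  comp_r S D
  = (comp_r S D.1, [seq (x.1, emb_comp (inc_r S n) x.2) | x <- D.2]).
Proof. by move=> le_mn /=; case: eqP => // e; rewrite e ltnn in le_mn. Qed.

(** Each entry is composed with [inc_l m n], which is an identity, so the list survives and only the
    source changes. *)
Lemma comp_l_lt m n (S : diagram X m.+1) (D : diagram X n) : n <= m ->
  comp_l D S = (comp_l D S.1, S.2).
Proof.
move=> le_nm /=; case: eqP => [e|_]; first by rewrite e ltnn in le_nm.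
by rewrite -[in RHS](map_id S.2); congr pair; apply: eq_map => -[g e];
  rewrite inc_l_id emb_comp_id.
Qed.

Lemma len_comp_r m n (S : diagram X m) (D : diagram X n) :
  m < n -> len (comp_r S D) = len D.
Proof. by case: n D => // n D lt_mn; rewrite comp_r_lt //= size_map. Qed.

Lemma len_comp_l m n (S : diagram X m) (D : diagram X n) :
  n < m -> len (comp_l D S) = len S.
Proof. by case: m S => // m S lt_nm; rewrite comp_l_lt. Qed.

(** * Associativity, by the position of the factor of largest dimension *)

Lemma comp_l_comp_eq m n (S : diagram X m) (D M : diagram X n) :
  0 < n <= m -> comp_l (comp_eq D M) S = comp_l M (comp_l D S).
Proof.
case/andP=> n_gt0; elim: m S => [|m IHm] S; first by rewrite leqNgt n_gt0.
rewrite leq_eqVlt => /predU1P[e | lt_nm]; last by rewrite !comp_l_lt //= IHm.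
by subst n; rewrite !comp_l_eq //= catA.
Qed.

Lemma comp_r_comp_eq n l (S D : diagram X n) (M : diagram X l) :
  0 < n <= l -> comp_r (comp_eq S D) M = comp_r S (comp_r D M).
Proof.
case/andP=> n_gt0; elim: l M => [|l IHl] M; first by rewrite leqNgt n_gt0.
rewrite leq_eqVlt => /predU1P[e | lt_nl].
  by subst n; rewrite !comp_r_eq //= catA.
rewrite !comp_r_lt //= IHl //; congr pair; rewrite -map_comp.
(* Shifting by [inc_r D] and then by [inc_r S] is a single shift by the sum of the two lengths. *)
by apply: eq_map => x /=; rewrite inc_r_comp_eq // emb_compA.
Qed.

(** The largest factor stands in the middle. Above dimension [m], [S] shifts the entries of [D]
    while [M] leaves them alone, so the two actions commute; at dimension [m] three lists are
    concatenated. *)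
Lemma comp_r_comp_l m n (S M : diagram X m) (D : diagram X n) :
  0 < m <= n -> comp_r S (comp_l M D) = comp_l M (comp_r S D).
Proof.
case/andP=> m_gt0; elim: n D => [|n IHn] D; first by rewrite leqNgt m_gt0.
rewrite leq_eqVlt => /predU1P[e | lt_mn].
  by subst m; rewrite !comp_l_eq // !comp_r_eq //= catA.
by rewrite comp_l_lt // !comp_r_lt // comp_l_lt //= IHn.
Qed.

(** * Distributivity of a factor of strictly smallest dimension *)

Lemma comp_r_comp_r m n l
    (S : diagram X m) (D : diagram X n) (M : diagram X l) : m < n <= l ->
  comp_r S (comp_r D M) = comp_r (comp_r S D) (comp_r S M).
Proof.
case/andP=> lt_mn; elim: l M => [|l IHl] M;
  first by rewrite leqNgt (leq_trans _ lt_mn).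
rewrite leq_eqVlt => /predU1P[e | lt_nl].
  (* Entries of [D] and of [M] receive the same shift [inc_r S], so shifting commutes with
     concatenation. *)
  by subst n; rewrite !comp_r_eq // !comp_r_lt //= map_cat.
have lt_ml := ltn_trans lt_mn lt_nl.
rewrite (comp_r_lt D) // !comp_r_lt //= IHl //; congr pair; rewrite -!map_comp.
apply: eq_map => x /=.
(* The shifts by [S] and by [D] occur in opposite orders, and [inc_r] does not distinguish
   [comp_r S D] from [D], as their lengths agree. *)
by rewrite emb_compCA (eq_inc_r _ (len_comp_r S D lt_mn)).
Qed.

Lemma comp_r_comp_l_distr m n l
    (S : diagram X m) (D : diagram X n) (M : diagram X l) : m < l <= n ->
  comp_r S (comp_l M D) = comp_l (comp_r S M) (comp_r S D).
Proof.
case/andP=> lt_ml; elim: n D => [|n IHn] D;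
  first by rewrite leqNgt (leq_trans _ lt_ml).
rewrite leq_eqVlt => /predU1P[e | lt_ln].
  by subst l; rewrite !comp_l_eq // !comp_r_lt //= map_cat.
have lt_mn := ltn_trans lt_ml lt_ln.
by rewrite comp_l_lt // !(@comp_r_lt m n) // comp_l_lt //= IHn.
Qed.

Lemma comp_l_comp_r m n l
    (S : diagram X m) (D : diagram X n) (M : diagram X l) : l < m <= n ->
  comp_l M (comp_r S D) = comp_r (comp_l M S) (comp_l M D).
Proof.
case/andP=> lt_lm; elim: n D => [|n IHn] D;
  first by rewrite leqNgt (leq_trans _ lt_lm).
rewrite leq_eqVlt => /predU1P[e | lt_mn].
  by subst m; rewrite !comp_r_eq // !comp_l_lt.
have lt_ln := ltn_trans lt_lm lt_mn.
rewrite comp_r_lt // !(@comp_l_lt n) // comp_r_lt //= IHn //.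
by rewrite (eq_inc_r _ (len_comp_l S M lt_lm)).
Qed.

Lemma comp_l_comp_l m n l
    (S : diagram X m) (D : diagram X n) (M : diagram X l) : l < n <= m ->
  comp_l M (comp_l D S) = comp_l (comp_l M D) (comp_l M S).
Proof.
case/andP=> lt_ln; elim: m S => [|m IHm] S;
  first by rewrite leqNgt (leq_trans _ lt_ln).
rewrite leq_eqVlt => /predU1P[e | lt_nm].
  by subst n; rewrite !comp_l_eq // !comp_l_lt.
have lt_lm := ltn_trans lt_ln lt_nm.
by rewrite (comp_l_lt _ D) // !(@comp_l_lt m) //= IHm.
Qed.

(** * The three laws for [compose] in arbitrary dimensions *)

Local Notation bundle := (Tagged (diag (gen X))).

(* On diagrams bundled with their dimension, equations between dimensions need
   no casts. *)
Definition tcompose (S D : {k & diagram X k}) : {k & diagram X k} :=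
  bundle (compose (tagged S) (tagged D)).

Lemma tcompose_r m n (S : diagram X m) (D : diagram X n) :
  m < n -> tcompose (bundle S) (bundle D) = bundle (comp_r S D).
(* Unfolding [maxn] makes the dimension and the composite branch on the same boolean. *)
Proof. by rewrite /tcompose /compose /maxn /=; case: (m < n). Qed.

Lemma tcompose_l m n (S : diagram X m) (D : diagram X n) :
  n <= m -> tcompose (bundle S) (bundle D) = bundle (comp_l D S).
Proof. by rewrite leqNgt /tcompose /compose /maxn /=; case: (m < n). Qed.

(** The equation of minima forces the two smaller dimensions to coincide. Comparing [n] with [l]
    then tells which factor may be larger: [M], [D] or [S]. *)
Lemma composeA m n l (S : diagram X m) (D : diagram X n) (M : diagram X l) :
  0 < m -> 0 < n -> 0 < l -> minn n l = minn m (maxn n l) ->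
  deq (compose S (compose D M)) (compose (compose S D) M).
Proof.
move=> m_gt0 n_gt0 l_gt0 eq_ab.
change (tcompose (bundle S) (tcompose (bundle D) (bundle M))
        = tcompose (tcompose (bundle S) (bundle D)) (bundle M)).
case: (ltngtP n l) => nl.
- have e : m = n by lia.
  subst m; rewrite (tcompose_r D) // (tcompose_r S) // (tcompose_l S) //.
  rewrite (tcompose_r _ M) // comp_l_eq // comp_r_comp_eq //; lia.
- have e : m = l by lia.
  subst m; rewrite (tcompose_l D) ?(ltnW nl) // !(tcompose_r S) //.
  by rewrite (tcompose_l _ M) ?(ltnW nl) // comp_r_comp_l // l_gt0 ltnW.
- have le_nm : n <= m by lia.
  subst l; rewrite (tcompose_l D) // !(tcompose_l S) // (tcompose_l _ M) //.
  by rewrite comp_l_eq // comp_l_comp_eq // n_gt0.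
Qed.

Lemma composeDl m n l (S : diagram X m) (D : diagram X n) (M : diagram X l) :
  m < minn n l ->
  deq (compose S (compose D M)) (compose (compose S D) (compose S M)).
Proof.
rewrite leq_min => /andP[lt_mn lt_ml].
change (tcompose (bundle S) (tcompose (bundle D) (bundle M))
        = tcompose (tcompose (bundle S) (bundle D))
                   (tcompose (bundle S) (bundle M))).
rewrite (tcompose_r S D) // (tcompose_r S M) //; case: (ltnP n l) => nl.
- by rewrite !tcompose_r // comp_r_comp_r // lt_mn ltnW.
- by rewrite !(tcompose_l _ _ nl) tcompose_r // comp_r_comp_l_distr // lt_ml.
Qed.

Lemma composeDr m n l (S : diagram X m) (D : diagram X n) (M : diagram X l) :
  l < minn m n ->
  deq (compose (compose S D) M) (compose (compose S M) (compose D M)).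
Proof.
rewrite leq_min => /andP[lt_lm lt_ln].
change (tcompose (tcompose (bundle S) (bundle D)) (bundle M)
        = tcompose (tcompose (bundle S) (bundle M))
                   (tcompose (bundle D) (bundle M))).
rewrite (tcompose_l S M (ltnW lt_lm)) (tcompose_l D M (ltnW lt_ln)).
case: (ltnP m n) => mn.
- rewrite !(tcompose_r _ _ mn) (tcompose_l _ _ (ltnW lt_ln)).
  by rewrite comp_l_comp_r // lt_lm ltnW.
- rewrite !(tcompose_l _ _ mn) (tcompose_l _ _ (ltnW lt_lm)).
  by rewrite comp_l_comp_l // lt_ln.
Qed.

End Compositions.

Theorem theorem94 (X : presignature) (N : nat) (HX : is_signature X N)
  (n m l : nat) (hn : 1 <= n <= N) (hm : 1 <= m <= N) (hl : 1 <= l <= N)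
  (D : diagram X n) (S : diagram X m) (M : diagram X l)
  (wdD : wd D) (wdS : wd S) (wdM : wd M) :
  let a := minn n l - 1 in
  let b := minn m (maxn n l) - 1 in
  let c := minn m n - 1 in
  let d := minn (maxn m n) l - 1 in
  [/\ a = b ->
        composable D M -> composable S (compose D M) ->
        composable S D -> composable (compose S D) M ->
        deq (compose S (compose D M)) (compose (compose S D) M),
      b < a ->
        composable D M -> composable S (compose D M) ->
        composable S D -> composable S M ->
        composable (compose S D) (compose S M) ->
        deq (compose S (compose D M)) (compose (compose S D) (compose S M))
    & d < c ->
        composable S D -> composable (compose S D) M ->
        composable S M -> composable D M ->
        composable (compose S M) (compose D M) ->
        deq (compose (compose S D) M) (compose (compose S M) (compose D M))].
Proof.
case/andP: hn => n_gt0 _; case/andP: hm => m_gt0 _; case/andP: hl => l_gt0 _.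
move=> a b c d; split=> [eq_ab _ _ _ _ | lt_ba _ _ _ _ _ | lt_dc _ _ _ _ _].
(* All dimensions are positive, so the truncated subtraction of 1 can be cancelled. *)
- by apply: composeA => //; lia.
(* As [minn n l <= maxn n l], the inequality [b < a] can only come from [m < minn n l]; dually,
   [d < c] gives [l < minn m n]. *)
- by apply: composeDl; lia.
- by apply: composeDr; lia.
Qed.
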